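(* For any integers $n\ge2$ and $t\ge2n$, there exists a Markov chain with state space $S$ of size $n$ and states $x,y\in S$ such that $$\mathbf{P}_x(\tau(y)=t)\ge\frac{n}{8t}.$$
   Context: Markov chains are in discrete time and time-homogeneous. $\mathbf{P}_x$ denotes the probability for the chain $\{X_t\}_{t\ge0}$ started at $X_0=x$. The hitting time is $\tau(y)=\min\{t\ge 0: X_t=y\}$ ($\infty$ if $y$ is never reached). *)

(* Defs.v *)
From HB Require Import structures.
From mathcomp Require Import all_boot all_order all_algebra.
From mathcomp Require Import all_classical all_reals all_analysis.

Set Implicit Arguments.
Unset Strict Implicit.
Unset Printing Implicit Defensive.

Import Order.TTheory GRing.Theory Num.Theory.

Local Open Scope classical_set_scope.
Local Open Scope ring_scope.

Definition cond_prob (R : realType) (d : measure_display)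
    (T : measurableType d) (P : probability T R) (A B : set T) : R :=
  fine (P (A `&` B)) / fine (P B).

Definition history (S T : Type) (X : nat -> T -> S) (k : nat) (s : nat -> S) :
    set T :=
  [set w | forall i, (i <= k)%N -> X i w = s i].

(* All starting states share one process X on one measurable space; [mc_P x] is
   the law P_x.  Since S is finite, measurability of the events {X_k = s} is
   measurability of X_k for the discrete sigma-algebra on S. *)
Record markov_chain (R : realType) (S : finType) := MarkovChain {
  mc_display : measure_display;
  mc_space : measurableType mc_display;
  mc_X : nat -> mc_space -> S;
  mc_P : S -> probability mc_space R;
  mc_trans : S -> S -> R;
  mc_measurable : forall k s, measurable (mc_X k @^-1` [set s]);
  mc_trans_ge0 : forall a b, 0 <= mc_trans a b;
  mc_trans_sum1 : forall a, \sum_(b : S) mc_trans a b = 1;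
  mc_start : forall x, mc_P x (mc_X 0%N @^-1` [set x]) = 1%E;
  mc_markov : forall x k (s : nat -> S) (b : S),
    (0 < mc_P x (history mc_X k s))%E ->
    cond_prob (mc_P x) (mc_X k.+1 @^-1` [set b]) (history mc_X k s)
      = mc_trans (s k) b
}.

(* tau(y) = min {k >= 0 : X_k = y}, with [None] standing for infinity. *)
Definition hitting_time (S : eqType) (T : Type) (X : nat -> T -> S) (y : S)
    (w : T) : option nat :=
  match pselect (exists k, X k w == y) with
  | left h => Some (ex_minn h)
  | right _ => None
  end.

(* Main.v *)
Require Import Defs.
From HB Require Import structures.
From mathcomp Require Import all_boot all_order all_algebra.
From mathcomp Require Import all_classical all_reals all_analysis.
From mathcomp Require Import zify ring lra.

Import Order.TTheory GRing.Theory Num.Theory.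

Local Open Scope classical_set_scope.
Local Open Scope ring_scope.

(** The chain runs around a cycle of [m = n - 1] states; each time it reaches
    the end of the cycle it jumps to the absorbing target [0] with probability
    [1 - q] and restarts the cycle with probability [q].  A non-target state is
    numbered by the number of steps to the next possible jump, so from [r > 0]
    the hitting time of [0] is [r + m * G] with [G] geometric.  The trajectory
    is a function of this hitting time alone, so [nat] serves as the sample
    space, a point [w] being the hitting time itself.  Writing
    [t = r + m * k] with [1 <= r <= m], the choice [1 - q = 1 / (2 * k)] and
    Bernoulli's inequality give [P_r(tau(0) = t) = (1 - q) * q ^+ k >= 1 / (4 * k)]. *)

(** * The geometric distribution and its images *)

Section GeometricLaw.
Context {R : realType} {d : measure_display} {T : measurableType d}.
Variables (q : R) (q_ge0 : 0 <= q) (q_lt1 : q < 1) (h : nat -> T).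

Lemma geometric_weight_ge0 g : 0 <= (1 - q) * q ^+ g.
Proof. by rewrite mulr_ge0 ?subr_ge0 ?(ltW q_lt1)// exprn_ge0. Qed.

(** The image under [h] of the geometric distribution, as a countable mixture of Dirac masses. *)
Definition geometric_law : set T -> \bar R :=
  mseries (fun g => mscale (NngNum (geometric_weight_ge0 g)) \d_(h g)) 0.

HB.instance Definition _ := Measure.on geometric_law.

Lemma geometric_lawE (A : set T) :
  geometric_law A = (\sum_(0 <= g <oo) ((1 - q) * q ^+ g)%:E * \d_(h g) A)%E.
Proof. by []. Qed.

Lemma geometric_law_null (A : set T) :
  (forall g, ~ A (h g)) -> geometric_law A = 0%E.
Proof.
move=> hA; rewrite geometric_lawE eseries0// => g _ _.
by rewrite diracE memNset ?mule0.
Qed.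

(** From index [g0] on, the masses form a geometric series with first term [(1 - q) * q ^+ g0] and
    ratio [q], so the factor [1 - q] cancels. *)
Lemma geometric_law_tail (A : set T) (g0 : nat) :
  (forall g, A (h g) <-> (g0 <= g)%N) -> geometric_law A = (q ^+ g0)%:E.
Proof.
move=> hA; rewrite geometric_lawE.
rewrite (nneseries_split 0 g0); last first.
  by move=> g _; rewrite mule_ge0// lee_fin geometric_weight_ge0.
rewrite add0n big1_seq ?add0e; last first.
  move=> g; rewrite mem_index_iota => /and3P[_ _ gg0].
  by rewrite diracE memNset ?mule0// => /hA; rewrite leqNgt gg0.
rewrite -nneseries_addn; last first.
  by move=> g; rewrite mule_ge0// lee_fin geometric_weight_ge0.
transitivity (\sum_(0 <= g <oo) (geometric ((1 - q) * q ^+ g0) q g)%:E)%E.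
  apply: eq_eseriesr => g _; rewrite diracE mem_set ?mule1; last first.
    by apply/hA; rewrite leq_addl.
  by rewrite /= addnC exprD mulrA.
apply/cvg_lim => //.
have q1 : `|q| < 1 by rewrite ger0_norm.
have := @cvg_geometric_series _ ((1 - q) * q ^+ g0) q q1.
rewrite mulrAC mulfV ?mul1r ?subr_eq0 ?gt_eqF// => geo.
apply: cvg_EFin; first by apply: nearW => n; rewrite sumEFin.
by under eq_fun do rewrite /= sumEFin.
Qed.

Lemma geometric_law_atom (A : set T) (g0 : nat) :
  (forall g, A (h g) <-> g = g0) ->
  geometric_law A = ((1 - q) * q ^+ g0)%:E.
Proof.
move=> hA; rewrite geometric_lawE (@nneseriesD1 _ _ g0)//; last first.
  by move=> g _; rewrite mule_ge0// lee_fin geometric_weight_ge0.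
rewrite diracE mem_set ?mule1; last exact/hA.
rewrite eseries0 ?adde0// => g _ gg0.
by rewrite diracE memNset ?mule0// => /hA /eqP; rewrite (negbTE gg0).
Qed.

Lemma geometric_law_setT : geometric_law setT = 1%E.
Proof. by rewrite (geometric_law_tail _ 0%N). Qed.

HB.instance Definition _ :=
  Measure_isProbability.Build _ _ _ geometric_law geometric_law_setT.

End GeometricLaw.

(** * The cycle chain; its cycle length is [m.+1] *)

Section CycleChain.
Context {R : realType} (m : nat).

(** Residues modulo [m.+1] are represented by 1, ..., [m.+1], because 0 is reserved for the
    target. *)
Definition steps_to_jump (w : nat) : nat :=
  if w is w'.+1 then (w' %% m.+1).+1 else 0%N.

Lemma steps_to_jump_lt w : (steps_to_jump w < m.+2)%N.
Proof. by case: w => //= w; rewrite ltnS ltn_pmod. Qed.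

(** Truncated subtraction keeps the trajectory at 0 from time [w] on. *)
Definition cycle_state (i w : nat) : 'I_m.+2 :=
  Ordinal (steps_to_jump_lt (w - i)).

Definition cycle_hit (x : 'I_m.+2) (g : nat) : nat :=
  if x == 0%N :> nat then 0%N else (x + m.+1 * g)%N.

Variables (q : R) (q_ge0 : 0 <= q) (q_lt1 : q < 1).

Definition cycle_law (x : 'I_m.+2) : probability nat R :=
  geometric_law q q_ge0 q_lt1 (cycle_hit x).

Lemma cycle_law_null x (A : set nat) :
  (forall g, ~ A (cycle_hit x g)) -> cycle_law x A = 0%E.
Proof. exact: geometric_law_null. Qed.

Lemma cycle_law_tail x (A : set nat) g0 :
  (forall g, A (cycle_hit x g) <-> (g0 <= g)%N) ->
  cycle_law x A = (q ^+ g0)%:E.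
Proof. exact: geometric_law_tail. Qed.

Lemma cycle_law_atom x (A : set nat) g0 :
  (forall g, A (cycle_hit x g) <-> g = g0) ->
  cycle_law x A = ((1 - q) * q ^+ g0)%:E.
Proof. exact: geometric_law_atom. Qed.

(** Only state 1 moves at random; since [0.-1 = 0], the second branch also makes the target
    absorbing. *)
Definition cycle_trans (a b : 'I_m.+2) : R :=
  if a == 1%N :> nat
  then (1 - q) * (b == ord0)%:R + q * (b == ord_max)%:R
  else (b == a.-1 :> nat)%:R.

Lemma steps_to_jumpS d : steps_to_jump d != 1%N ->
  steps_to_jump d.-1 = (steps_to_jump d).-1.
Proof.
case: d => [|[|d]] //=.
by rewrite [(d.+1 %% _)%N]modnS; case: ifP.
Qed.

Lemma steps_to_jump1 d : (steps_to_jump d == 1%N) =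
  (0 < d)%N && (m.+1 %| d.-1)%N.
Proof. by case: d. Qed.

Lemma steps_to_jumpD d c : (0 < d)%N ->
  steps_to_jump (d + m.+1 * c) = steps_to_jump d.
Proof. by case: d => //= d _; rewrite addnC mulnC modnMDl. Qed.

Lemma steps_to_jump_id (x : 'I_m.+2) : steps_to_jump x = x.
Proof.
case: x => -[|x] //= xm.
by rewrite modn_small.
Qed.

Lemma cycle_start x : cycle_law x (cycle_state 0 @^-1` [set x]) = 1%E.
Proof.
rewrite (cycle_law_tail _ _ 0%N)// => g; split=> // _ /=.
apply/val_inj; rewrite /= subn0 /cycle_hit.
case: eqP => [x0|/eqP]; first by rewrite x0.
by rewrite -lt0n => x0; rewrite steps_to_jumpD// steps_to_jump_id.
Qed.

Lemma cycle_trans_ge0 a b : 0 <= cycle_trans a b.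
Proof.
rewrite /cycle_trans; case: ifP => // _.
by rewrite addr_ge0// mulr_ge0// subr_ge0 ltW.
Qed.

Lemma cycle_trans_sum1 a : \sum_b cycle_trans a b = 1.
Proof.
rewrite /cycle_trans; case: (a == 1%N :> nat).
  rewrite big_split /= -!mulr_sumr.
  have sum_delta (c : 'I_m.+2) : \sum_b (b == c)%:R = 1 :> R.
    by rewrite (bigD1 c)//= eqxx big1 ?addr0// => b /negbTE ->.
  by rewrite !sum_delta; ring.
have am : (a.-1 < m.+2)%N by rewrite (leq_ltn_trans (leq_pred a)).
rewrite (bigD1 (Ordinal am))//= eqxx big1 ?addr0// => b.
by rewrite -val_eqE /= => /negbTE ->.
Qed.

(* At state 1 the past fixes the residue of the hitting time and nothing else. *)
Lemma cycle_history_tail x k (s : nat -> 'I_m.+2) :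
  s k = 1%N :> nat -> (0 < cycle_law x (history cycle_state k s))%E ->
  exists g0, forall g,
    [/\ history cycle_state k s (cycle_hit x g) <-> (g0 <= g)%N
      & (g0 <= g)%N -> cycle_hit x g = (k.+1 + m.+1 * (g - g0))%N].
Proof.
move=> sk Hgt0.
have [g Hg] : exists g, history cycle_state k s (cycle_hit x g).
  apply: contrapT => /forallNP noH.
  by rewrite cycle_law_null ?ltxx in Hgt0.
have hitE g' : history cycle_state k s (cycle_hit x g') ->
    (k < cycle_hit x g')%N && (m.+1 %| (cycle_hit x g' - k).-1)%N.
  move=> /(_ k (leqnn k)) /(congr1 val) /= /eqP.
  by rewrite sk steps_to_jump1 subn_gt0.
have /andP[kg /dvdnP[c cE]] := hitE _ Hg.
have x0 : (0 < x)%N.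
  by rewrite lt0n; apply: contraTN kg => /eqP x0; rewrite /cycle_hit x0.
have hitx g' : cycle_hit x g' = (x + m.+1 * g')%N.
  by rewrite /cycle_hit gtn_eqF.
have xm : (x <= m.+1)%N by rewrite -ltnS.
rewrite hitx in kg cE.
have xgE : (x + m.+1 * g = k.+1 + m.+1 * c)%N by rewrite [(m.+1 * c)%N]mulnC -cE; lia.
(* Otherwise [k.+1 + m.+1 * c] would exceed [m.+1 * g.+1], which bounds [x + m.+1 * g]. *)
have cg : (c <= g)%N.
  by rewrite leqNgt; apply/negP => gc; nia.
(* With [g - c] restarts the hitting time is exactly [k.+1]; further restarts add whole cycles,
   which leave the states up to time [k] unchanged. *)
exists (g - c)%N => g'.
have hit' : (g - c <= g')%N -> cycle_hit x g' = (k.+1 + m.+1 * (g' - (g - c)))%N.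
  by rewrite hitx => gg; nia.
split=> //; split=> [/hitE /andP[+ _]|gg i ik].
  by rewrite hitx => kg'; rewrite leqNgt; apply/negP => gg; nia.
have := Hg _ ik; rewrite hitx xgE => <-; apply/val_inj => /=.
by rewrite hit'// -!addnBAC ?(leq_trans ik)// !steps_to_jumpD// subn_gt0 ltnS.
Qed.

(** Away from state 1 the current state determines the next one. At state 1 the history is a tail
    event of the geometric variable, and the claim is its memorylessness: the least value in the
    tail leads to the target, all others to [ord_max]. *)
Lemma cycle_markov x k (s : nat -> 'I_m.+2) b :
  (0 < cycle_law x (history cycle_state k s))%E ->
  cond_prob (cycle_law x) (cycle_state k.+1 @^-1` [set b])
    (history cycle_state k s) = cycle_trans (s k) b.
Proof.
move=> Hgt0; rewrite /cond_prob /cycle_trans; case: ifPn => [/eqP sk|sk]; last first.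
  have next w : history cycle_state k s w ->
      cycle_state k.+1 w = (s k).-1 :> nat.
    move=> /(_ k (leqnn k)) sE.
    by rewrite -sE /= subnS steps_to_jumpS//; rewrite -sE in sk.
  have [bs|bs] := eqVneq.
    rewrite (_ : _ `&` _ = history cycle_state k s).
      by rewrite divff// fine_eq0 ?gt_eqF// fin_num_measure.
    apply/setIidPr => w /next wE; apply/val_inj.
    exact: etrans wE (esym bs).
  rewrite (_ : _ `&` _ = set0) ?measure0 ?mul0r//.
  by apply/seteqP; split=> // w [/= wb /next]; rewrite wb => /eqP; rewrite (negbTE bs).
have [g0 hg0] := cycle_history_tail _ _ _ sk Hgt0.
have HE g : history cycle_state k s (cycle_hit x g) <-> (g0 <= g)%N.
  by have [] := hg0 g.
have nextE g : (g0 <= g)%N -> cycle_state k.+1 (cycle_hit x g) =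
    if g == g0 then ord0 else ord_max.
  have [_ hE] := hg0 g => gg; apply/val_inj; rewrite /= hE// addKn.
  have [->|gn] := eqVneq g g0; first by rewrite subnn muln0.
  have -> : (m.+1 * (g - g0) = m.+1 + m.+1 * (g - g0).-1)%N by nia.
  by rewrite steps_to_jumpD//= modn_small.
(* The value [q = 0] is allowed; a vanishing power would make the history a null event. *)
have [q0|qn0] := eqVneq (q ^+ g0) 0.
  by move: Hgt0; rewrite (cycle_law_tail _ _ g0)// q0 ltxx.
rewrite [in X in _ / X](cycle_law_tail _ _ g0)//.
have [->|b0] := eqVneq b ord0.
  rewrite (cycle_law_atom _ _ g0) => [|g].
    by rewrite /= mulr0 mulr1 addr0 mulfK.
  split=> [[/= + /HE gg]|->]; first by rewrite nextE//; case: eqP.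
  by split; [rewrite /= nextE// eqxx|exact/HE].
have [->|bm] := eqVneq b ord_max.
  rewrite (cycle_law_tail _ _ g0.+1) => [|g].
    by rewrite /= mulr0 mulr1 add0r exprS mulfK.
  split=> [[/= + /HE gg]|gg].
    by rewrite nextE// ltn_neqAle gg eq_sym andbT; case: eqP.
  by split; [rewrite /= nextE ?(ltnW gg)// gtn_eqF|exact/HE/ltnW].
rewrite cycle_law_null ?mul0r ?mulr0 ?addr0// => g [/= + /HE gg].
rewrite nextE//; case: ifP => _ /esym/eqP; first by rewrite (negbTE b0).
by rewrite (negbTE bm).
Qed.

(** Every subset of [nat] is measurable, so measurability reduces to [True]. *)
Definition cycle_chain : markov_chain R 'I_m.+2 :=
  @MarkovChain R 'I_m.+2 _ nat cycle_state cycle_law cycle_trans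
    (fun _ _ => Logic.I) cycle_trans_ge0 cycle_trans_sum1 cycle_start
    cycle_markov.

Lemma hitting_time_cycle w : hitting_time cycle_state ord0 w = Some w.
Proof.
have hit0 k : (cycle_state k w == ord0) = (w <= k)%N.
  by rewrite -val_eqE /= -subn_eq0; case: (w - k)%N.
rewrite /hitting_time; case: pselect => [ex|[]]; last first.
  by exists w; rewrite hit0.
congr Some; case: ex_minnP => k; rewrite hit0 => wk /(_ w).
by rewrite hit0 leqnn => /(_ isT) kw; apply/eqP; rewrite eqn_leq kw.
Qed.

Lemma cycle_chain_hitting (x : 'I_m.+2) k : (0 < x)%N ->
  mc_P cycle_chain x
    [set w | hitting_time (mc_X (m := cycle_chain)) ord0 w
             = Some (x + m.+1 * k)%N] = ((1 - q) * q ^+ k)%:E.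
Proof.
move=> x0; apply: cycle_law_atom => g.
rewrite /= hitting_time_cycle /cycle_hit gtn_eqF//.
by split=> [[/addnI/eqP]|->//]; rewrite eqn_mul2l => /eqP.
Qed.

End CycleChain.

(** * Choice of the parameters and the lower bound *)

Lemma bernoulli_ineq (R : realDomainType) (p : R) k :
  0 <= p <= 1 -> 1 - k%:R * p <= (1 - p) ^+ k.
Proof.
move=> /andP[p0 p1]; elim: k => [|k IH]; first by rewrite mul0r subr0 expr0.
rewrite exprS; apply: le_trans (ler_wpM2l _ IH); last by rewrite subr_ge0.
have k0 : 0 <= k%:R :> R by [].
(* The two sides differ by [k%:R * p ^+ 2]. *)
rewrite -natr1; nra.
Qed.

Theorem claim2p1 (R : realType) (n t : nat) (hn : (2 <= n)%N)
    (ht : (2 * n <= t)%N) :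
  exists (S : finType) (M : markov_chain R S) (x y : S),
    #|S| = n /\
    ((n%:R / (8 * t%:R) : R)%:E
       <= mc_P M x [set w | hitting_time (mc_X (m := M)) y w = Some t])%E.
Proof.
case: n hn ht => [|[|m]] // _ ht.
(* Dividing [t.-1] instead of [t] puts the starting state, remainder plus one, between 1 and [m.+1],
   off the target. *)
pose k := (t.-1 %/ m.+1)%N.
have rm : ((t.-1 %% m.+1).+1 < m.+2)%N by rewrite ltnS ltn_pmod.
have tE : t = (Ordinal rm + m.+1 * k)%N.
  by rewrite /= addSn addnC mulnC -divn_eq prednK//; lia.
have k0 : (0 < k)%N by rewrite divn_gt0//; lia.
(* Here [k * m.+1 <= t] and [m.+2 <= 2 * m.+1]; this factor 2 turns [1 / (4 * k)] into the bound
   with constant 8. *)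
have kt : (k * m.+2 <= 2 * t)%N by nia.
have kR : 1 <= k%:R :> R by rewrite ler1n.
have tR : 1 <= t%:R :> R by rewrite ler1n; lia.
pose p : R := (2 * k%:R)^-1.
have p01 : 0 < p <= 1.
  by rewrite invr_gt0 invf_le1; lra.
have [p0 p1] := andP p01.
have q0 : 0 <= 1 - p by rewrite subr_ge0.
have q1 : 1 - p < 1 by rewrite ltrBlDr ltrDl.
exists 'I_m.+2, (cycle_chain m (1 - p) q0 q1), (Ordinal rm), ord0.
split; first by rewrite card_ord.
have := cycle_chain_hitting m (1 - p) q0 q1 (Ordinal rm) k isT.
rewrite -tE => ->; rewrite lee_fin.
have half : 1 / 2 <= (1 - p) ^+ k.
  have <- : 1 - k%:R * p = 1 / 2 by rewrite /p; field; rewrite pnatr_eq0 -lt0n.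
  by apply: bernoulli_ineq; rewrite ltW.
apply: (@le_trans _ _ (p * (1 / 2))); last first.
  by rewrite opprB addrC subrK ler_wpM2l// ltW.
have nR : k%:R * m.+2%:R <= 2 * t%:R :> R by rewrite -!natrM ler_nat.
have -> : p * (1 / 2) = (4 * k%:R)^-1 by rewrite /p; field; rewrite pnatr_eq0 -lt0n.
rewrite ler_pdivrMr; last lra.
rewrite mulrC ler_pdivlMr; last lra.
lra.
Qed.
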